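(* Let $A\in\mathbb{R}^{n\times n}$ have no eigenvalues on the closed non-positive real axis, and let $X=A^{1/2}$ be its principal square root. Let $Z\in\mathbb{R}^{n\times n}$ be such that $B_Z=I_n\otimes Z+Z^{\top}\otimes I_n$ is invertible, and define $E_Z=Z-X$. Let $X_0\in\mathbb{R}^{n\times n}$ and let the sequence $\{X_k\}_{k\ge 0}$ be generated (in exact arithmetic) by $$\operatorname{vec}(X_{k+1})=\operatorname{vec}(X_k)+B_Z^{-1}\operatorname{vec}(A-X_k^2),\qquad k\ge 0 .$$ Then the errors $E_k=X_k-X$ satisfy, for all $k\ge 0$, $$\|E_{k+1}\|_{\mathsf F}\le 2\|B_Z^{-1}\|_2\,\|E_Z\|_{\mathsf F}\,\|E_k\|_{\mathsf F}+\|B_Z^{-1}\|_2\,\|E_k\|_{\mathsf F}^2 .$$ Moreover, if $$\rho_0=\|B_Z^{-1}\|_2\bigl(2\|E_Z\|_{\mathsf F}+\|E_0\|_{\mathsf F}\bigr)<1,$$ then $\|E_{k+1}\|_{\mathsf F}\le\rho_0\|E_k\|_{\mathsf F}$ for all $k\ge 0$, that is, the error converges at least linearly with rate $\rho_0$.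
   Context: $\|\cdot\|_2$ is the spectral norm and $\|\cdot\|_{\mathsf F}$ the Frobenius norm. $\otimes$ is the Kronecker product and $\operatorname{vec}(\cdot)$ stacks the columns of a matrix into a vector. The principal square root $A^{1/2}$ of a matrix $A$ with no eigenvalues on $\mathbb{R}_{\le 0}$ is the unique matrix $X$ with $X^2=A$ all of whose eigenvalues lie in the open right half-plane (it is real when $A$ is real). *)

(* Defs.v *)
From mathcomp Require Import all_boot all_order all_algebra.
From mathcomp Require Import complex mxtens.
From mathcomp Require Import all_classical all_reals all_analysis.

Set Implicit Arguments.
Unset Strict Implicit.
Unset Printing Implicit Defensive.

Import Order.TTheory GRing.Theory Num.Theory.
Import numFieldNormedType.Exports.

Local Open Scope classical_set_scope.
Local Open Scope ring_scope.

Definition frobenius_norm (R : realType) (m n : nat) (M : 'M[R]_(m, n)) : R :=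
  Num.sqrt (\sum_(i < m) \sum_(j < n) M i j ^+ 2).

(* The operator norm induced by the Euclidean norm; the Euclidean norm of a
   column vector is its Frobenius norm.  The default norm `|M| on matrices is
   the maximum of the entries, hence is not used here. *)
Definition spectral_norm (R : realType) (m n : nat) (M : 'M[R]_(m, n)) : R :=
  sup [set frobenius_norm (M *m v) | v in
        [set v : 'cV[R]_n | frobenius_norm v = 1]].

(* Column stacking: entry j * m + i of vec M is M i j, for i < m and j < n.
   mxvec enumerates the entries row by row instead.  The indexing is that of
   the Kronecker product tensmx. *)
Definition vec (R : realType) (m n : nat) (M : 'M[R]_(m, n)) : 'cV[R]_(n * m) :=
  \col_k M (mxtens_unindex k).2 (mxtens_unindex k).1.

Definition sylvester_mx (R : realType) (n : nat) (Z : 'M[R]_n) :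
    'M[R]_(n * n) :=
  tensmx (1%:M : 'M[R]_n) Z + tensmx Z^T (1%:M : 'M[R]_n).

Definition complex_mx (R : realType) (n : nat) (M : 'M[R]_n) : 'M[R[i]%C]_n :=
  map_mx (@real_complex R) M.

Definition no_nonpos_eigenvalue (R : realType) (n : nat)
    (A : 'M[R[i]%C]_n) : Prop :=
  forall r : R, r <= 0 -> ~~ eigenvalue A (real_complex R r).

Definition is_principal_sqrt (R : realType) (n : nat)
    (A X : 'M[R[i]%C]_n) : Prop :=
  X *m X = A /\
  forall lambda : R[i]%C, eigenvalue X lambda -> 0 < complex.Re lambda.

(* Main.v *)
Require Import Defs.
From mathcomp Require Import all_boot all_order all_algebra.
From mathcomp Require Import complex mxtens.
From mathcomp Require Import all_classical all_reals all_analysis.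
From mathcomp Require Import ring lra.

Import Order.TTheory GRing.Theory Num.Theory.
Import numFieldNormedType.Exports.

Local Open Scope classical_set_scope.
Local Open Scope ring_scope.

(** Write $E = X_k - X$ and $E_Z = Z - X$.  The matrix $B_Z$ represents the
    Sylvester operator $M \mapsto ZM + MZ$ on vectorized matrices
    ([sylvester_mx_vec]), and $A = X^2$, so that
    $A - X_k^2 = -(XE + EX + E^2)$ and the iteration becomes
    $$\mathrm{vec}(E_{k+1})
      = B_Z^{-1}\,\mathrm{vec}(E_Z E + E E_Z - E^2)$$
    ([sylvester_error_step]).  Vectorization preserves the Frobenius norm,
    which is a submultiplicative norm compatible with the spectral norm; taking
    norms gives the quadratic bound.  When $\rho_0 < 1$, induction shows that
    $\|E_k\|$ never exceeds $\|E_0\|$, so that the quadratic bound is at most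
    $\rho_0 \|E_k\|$ ([linear_rate_of_quadratic_bound]), and
    $\|E_k\| \le \rho_0^k \|E_0\|$ tends to $0$. *)

(** * Frobenius and spectral norms *)

(** Cauchy-Schwarz inequality, from the nonnegativity of
    $\sum_{i,j} (a_i b_j - a_j b_i)^2$. *)
Lemma cauchy_schwarz_sum {R : realFieldType} {I : finType} (a b : I -> R) :
  (\sum_i a i * b i) ^+ 2 <= (\sum_i a i ^+ 2) * (\sum_i b i ^+ 2).
Proof.
have : 0 <= \sum_i \sum_j (a i * b j - a j * b i) ^+ 2.
  by apply: sumr_ge0 => i _; apply: sumr_ge0 => j _; exact: sqr_ge0.
have -> : \sum_i \sum_j (a i * b j - a j * b i) ^+ 2 =
    \sum_i \sum_j (a i ^+ 2 * b j ^+ 2) + \sum_i \sum_j (b i ^+ 2 * a j ^+ 2)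
    - (\sum_i \sum_j (a i * b i) * (a j * b j)) *+ 2.
  rewrite -sumrMnl -big_split -sumrB /=; apply: eq_bigr => i _.
  rewrite -sumrMnl -big_split -sumrB /=; apply: eq_bigr => j _.
  ring.
rewrite -!big_distrlr /=; set s := \sum_i a i * b i.
by set sa := \sum_i a i ^+ 2; set sb := \sum_i b i ^+ 2; nra.
Qed.

Section FrobeniusNorm.
Context {R : realType}.

Lemma frobenius_norm_ge0 {m n} (M : 'M[R]_(m, n)) : 0 <= frobenius_norm M.
Proof. exact: sqrtr_ge0. Qed.

Lemma sqr_frobenius_norm {m n} (M : 'M[R]_(m, n)) :
  frobenius_norm M ^+ 2 = \sum_i \sum_j M i j ^+ 2.
Proof.
rewrite sqr_sqrtr //; apply: sumr_ge0 => i _; apply: sumr_ge0 => j _.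
exact: sqr_ge0.
Qed.

Lemma frobenius_normZ {m n} (c : R) (M : 'M[R]_(m, n)) :
  frobenius_norm (c *: M) = `|c| * frobenius_norm M.
Proof.
rewrite /frobenius_norm -sqrtr_sqr -sqrtrM ?sqr_ge0//; congr Num.sqrt.
rewrite mulr_sumr; apply: eq_bigr => i _; rewrite mulr_sumr.
by apply: eq_bigr => j _; rewrite mxE exprMn.
Qed.

Lemma frobenius_normN {m n} (M : 'M[R]_(m, n)) :
  frobenius_norm (- M) = frobenius_norm M.
Proof. by rewrite -scaleN1r frobenius_normZ normrN1 mul1r. Qed.

Lemma frobenius_norm0_eq0 {m n} {M : 'M[R]_(m, n)} :
  frobenius_norm M = 0 -> M = 0.
Proof.
move=> M0; have /eqP := sqr_frobenius_norm M.
rewrite M0 expr0n /= eq_sym psumr_eq0 => [/allP Mi0|i _]; last first.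
  by apply: sumr_ge0 => j _; exact: sqr_ge0.
apply/matrixP => i j; rewrite mxE.
have := Mi0 i (mem_index_enum i); rewrite psumr_eq0 => [/allP Mij0|k _]; last first.
  exact: sqr_ge0.
by have := Mij0 j (mem_index_enum j); rewrite sqrf_eq0 => /eqP.
Qed.

Lemma ler_frobenius_normD {m n} (M N : 'M[R]_(m, n)) :
  frobenius_norm (M + N) <= frobenius_norm M + frobenius_norm N.
Proof.
have N0 := @frobenius_norm_ge0.
rewrite -(@ler_pXn2r _ 2)// ?nnegrE ?addr_ge0// sqrrD !sqr_frobenius_norm.
have MN : \sum_i \sum_j M i j * N i j <= frobenius_norm M * frobenius_norm N.
  apply: le_trans (ler_norm _) _.
  rewrite -(@ler_pXn2r _ 2)// ?nnegrE ?mulr_ge0// exprMn.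
  rewrite real_normK ?num_real// !sqr_frobenius_norm !pair_bigA /=.
  exact: (cauchy_schwarz_sum (fun p => M p.1 p.2) (fun p => N p.1 p.2)).
have -> : \sum_i \sum_j (M + N) i j ^+ 2 =
    \sum_i \sum_j M i j ^+ 2 + (\sum_i \sum_j M i j * N i j) *+ 2
    + \sum_i \sum_j N i j ^+ 2.
  rewrite -sumrMnl -!big_split /=; apply: eq_bigr => i _.
  rewrite -sumrMnl -!big_split /=; apply: eq_bigr => j _.
  by rewrite mxE sqrrD.
by rewrite lerD2r lerD2l lerMn2r.
Qed.

Lemma ler_frobenius_normM {m n p} (M : 'M[R]_(m, n)) (N : 'M[R]_(n, p)) :
  frobenius_norm (M *m N) <= frobenius_norm M * frobenius_norm N.
Proof.
have N0 := @frobenius_norm_ge0.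
rewrite -(@ler_pXn2r _ 2)// ?nnegrE ?mulr_ge0// exprMn !sqr_frobenius_norm.
rewrite [X in _ * X]exchange_big /= big_distrlr /=.
apply: ler_sum => i _; apply: ler_sum => j _; rewrite mxE.
exact: cauchy_schwarz_sum.
Qed.

Lemma has_ubound_spectral_norm {m n} (M : 'M[R]_(m, n)) :
  has_ubound [set frobenius_norm (M *m v) | v in
    [set v : 'cV[R]_n | frobenius_norm v = 1]].
Proof.
exists (frobenius_norm M) => _ [v /= v1 <-].
by rewrite -[leRHS]mulr1 -v1 ler_frobenius_normM.
Qed.

Lemma spectral_norm_ge0 {m n} (M : 'M[R]_(m, n)) : 0 <= spectral_norm M.
Proof.
rewrite /spectral_norm; set S := [set _ | _ in _].
have [->|/set0P[_ [v v1 _]]] := eqVneq S set0.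
  (* for n = 0 there is no unit vector, and the supremum is 0 by convention *)
  by rewrite sup0.
apply: le_trans (frobenius_norm_ge0 (M *m v)) _.
by apply: (ub_le_sup (E := S)); [exact: has_ubound_spectral_norm | exists v].
Qed.

Lemma frobenius_norm_mulmx_col {m n} (M : 'M[R]_(m, n)) (v : 'cV[R]_n) :
  frobenius_norm (M *m v) <= spectral_norm M * frobenius_norm v.
Proof.
have := frobenius_norm_ge0 v; rewrite le_eqVlt => /orP[/eqP v0|v_gt0].
  rewrite -v0 mulr0 (frobenius_norm0_eq0 (esym v0)) mulmx0.
  by rewrite -(scale0r 0) frobenius_normZ normr0 mul0r.
(* normalize v to a unit vector, over which the supremum is taken *)
rewrite -ler_pdivrMr// mulrC.
have cN : `|(frobenius_norm v)^-1| = (frobenius_norm v)^-1.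
  by rewrite ger0_norm// invr_ge0 ltW.
rewrite -[X in X * _]cN -frobenius_normZ scalemxAr.
apply: ub_le_sup; first exact: has_ubound_spectral_norm.
by exists ((frobenius_norm v)^-1 *: v) => //=; rewrite frobenius_normZ cN mulVf// gt_eqF.
Qed.

End FrobeniusNorm.

(** * Vectorization and the Sylvester operator *)

Section Vectorization.
Context {R : realType}.

Lemma big_mxtens {m n} (F : 'I_(m * n) -> R) :
  \sum_k F k = \sum_i \sum_j F (mxtens_index (i, j)).
Proof.
rewrite pair_bigA (reindex (@mxtens_index m n)) /=.
  by apply: eq_bigr => -[].
exists (@mxtens_unindex m n) => k _; first exact: mxtens_indexK.
exact: mxtens_unindexK.
Qed.

Lemma vecD {m n} (M N : 'M[R]_(m, n)) : vec (M + N) = vec M + vec N.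
Proof. by apply/matrixP => i j; rewrite !mxE. Qed.

Lemma frobenius_norm_vec {m n} (M : 'M[R]_(m, n)) :
  frobenius_norm (vec M) = frobenius_norm M.
Proof.
congr Num.sqrt; rewrite big_mxtens exchange_big /=.
apply: eq_bigr => i _; apply: eq_bigr => j _.
by rewrite big_ord1 mxE mxtens_indexK.
Qed.

Lemma sylvester_mx_vec {n} (Z M : 'M[R]_n) :
  sylvester_mx Z *m vec M = vec (Z *m M + M *m Z).
Proof.
apply/matrixP => k l; rewrite !mxE big_mxtens.
under eq_bigr do under eq_bigr do rewrite !mxE !mxtens_indexK mulrDl /=.
under eq_bigr do rewrite big_split /=.
rewrite big_split /=; congr (_ + _).
  (* each identity factor of the Kronecker products collapses one sum *)
  rewrite (bigD1 (mxtens_unindex k).1)//= [X in _ + X]big1 ?addr0; last first.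
    move=> i /negPf ik; apply: big1 => j _.
    by rewrite eq_sym ik !mul0r.
  by apply: eq_bigr => j _; rewrite eqxx mul1r.
apply: eq_bigr => i _.
rewrite (bigD1 (mxtens_unindex k).2)//= big1 ?addr0; last first.
  by move=> j /negPf jk; rewrite eq_sym jk mulr0 mul0r.
by rewrite eqxx mulr1 mulrC.
Qed.

(** One step of the iteration, from [Y] to [Y'], written in terms of the errors
    with respect to [X]; the linear terms combine into the error of [Z] because
    $X^2 - Y^2 = -(X(Y-X) + (Y-X)X + (Y-X)^2)$. *)
Lemma sylvester_error_step {n} {X Y Y' Z : 'M[R]_n} :
  sylvester_mx Z \in unitmx ->
  vec Y' = vec Y + invmx (sylvester_mx Z) *m vec (X *m X - Y *m Y) ->
  vec (Y' - X) = invmx (sylvester_mx Z) *m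
    vec ((Z - X) *m (Y - X) + (Y - X) *m (Z - X) - (Y - X) *m (Y - X)).
Proof.
move=> ZU Y'E.
rewrite vecD Y'E addrAC -vecD -[vec (Y - X)](mulKmx ZU) -mulmxDr.
rewrite sylvester_mx_vec -vecD; congr (_ *m vec _).
rewrite !(mulmxBl, mulmxBr).
(* entrywise, the eight noncommutative products are atoms of an additive
   identity *)
set a := Z *m Y; set b := Z *m X; set c := Y *m Z; set d := X *m Z.
set e := X *m X; set f := Y *m Y; set g := X *m Y; set h := Y *m X.
by apply/matrixP => i j; rewrite !mxE; ring.
Qed.

End Vectorization.

Lemma complex_mx_principal_sqrt_mul {R : realType} {n : nat} (A X : 'M[R]_n) :
  is_principal_sqrt (complex_mx A) (complex_mx X) -> X *m X = A.
Proof.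
by move=> [XX _]; apply: (map_mx_inj (f := real_complex R)); rewrite map_mxM.
Qed.

(** * Convergence of the iteration *)

Lemma frobenius_norm_sylvester_error {R : realType} {n : nat}
    (X Y Y' Z : 'M[R]_n) :
  sylvester_mx Z \in unitmx ->
  vec Y' = vec Y + invmx (sylvester_mx Z) *m vec (X *m X - Y *m Y) ->
  frobenius_norm (Y' - X) <=
    2 * spectral_norm (invmx (sylvester_mx Z)) * frobenius_norm (Z - X)
      * frobenius_norm (Y - X)
    + spectral_norm (invmx (sylvester_mx Z)) * frobenius_norm (Y - X) ^+ 2.
Proof.
move=> ZU Y'E; rewrite -frobenius_norm_vec (sylvester_error_step ZU Y'E).
apply: le_trans (frobenius_norm_mulmx_col _ _) _.
rewrite frobenius_norm_vec -!mulrA mulrCA -mulrDr.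
apply: ler_wpM2l; first exact: spectral_norm_ge0.
apply: le_trans (ler_frobenius_normD _ _) _; rewrite frobenius_normN.
apply: lerD; last by rewrite expr2; exact: ler_frobenius_normM.
apply: le_trans (ler_frobenius_normD _ _) _.
rewrite mulr_natl mulr2n; apply: lerD; first exact: ler_frobenius_normM.
by rewrite mulrC; exact: ler_frobenius_normM.
Qed.

(** A nonnegative sequence with $e_{k+1} \le 2bd e_k + b e_k^2$ decreases at
    every step by the factor $b(2d + e_0)$ when that factor is less than $1$. *)
Lemma linear_rate_of_quadratic_bound {R : realFieldType} (b d : R)
    (e : nat -> R) :
  0 <= b -> 0 <= d -> (forall k, 0 <= e k) ->
  (forall k, e k.+1 <= 2 * b * d * e k + b * e k ^+ 2) ->
  b * (2 * d + e 0%N) < 1 ->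
  forall k, e k.+1 <= b * (2 * d + e 0%N) * e k.
Proof.
move=> b0 d0 e0 eS rho1.
have step k : e k <= e 0%N -> e k.+1 <= b * (2 * d + e 0%N) * e k.
  move=> ek; apply: le_trans (eS k) _.
  have := ler_wpM2l (mulr_ge0 b0 (e0 k)) ek; nra.
suff ek k : e k <= e 0%N by move=> k; exact: step.
elim: k => // k ek; apply: le_trans (step _ ek) _.
by apply: le_trans ek; rewrite -[leRHS]mul1r ler_wpM2r// ltW.
Qed.

Lemma cvg_to_0_linear_rate {R : realType} (r : R) (e : nat -> R) :
  0 <= r -> r < 1 -> (forall k, 0 <= e k) ->
  (forall k, e k.+1 <= r * e k) -> e k @[k --> \oo] --> (0 : R).
Proof.
move=> r0 r1 e0 eS.
have geo k : e k <= e 0%N * r ^+ k.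
  elim: k => [|k IH]; first by rewrite expr0 mulr1.
  apply: le_trans (eS k) _; rewrite exprS mulrCA.
  exact: ler_wpM2l.
apply: (@squeeze_cvgr _ _ _ _ (fun=> 0) (fun k => e 0%N * r ^+ k)).
- by apply: nearW => k; rewrite e0 geo.
- exact: cvg_cst.
- by apply: cvg_geometric; rewrite ger0_norm.
Qed.

Theorem theorem3p1 (R : realType) (n : nat) (A X Z : 'M[R]_n)
    (Xs : nat -> 'M[R]_n)
    (hA : no_nonpos_eigenvalue (complex_mx A))
    (hX : is_principal_sqrt (complex_mx A) (complex_mx X))
    (hB : sylvester_mx Z \in unitmx)
    (hXs : forall k : nat,
       vec (Xs k.+1) =
       vec (Xs k) + invmx (sylvester_mx Z) *m vec (A - Xs k *m Xs k)) :
  let b : R := spectral_norm (invmx (sylvester_mx Z)) in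
  let EZ : 'M[R]_n := Z - X in
  let E (k : nat) : 'M[R]_n := Xs k - X in
  let rho0 : R := b * (2 * frobenius_norm EZ + frobenius_norm (E 0%N)) in
  (forall k : nat,
     frobenius_norm (E k.+1) <=
     2 * b * frobenius_norm EZ * frobenius_norm (E k)
     + b * frobenius_norm (E k) ^+ 2) /\
  (rho0 < 1 ->
     (forall k : nat,
        frobenius_norm (E k.+1) <= rho0 * frobenius_norm (E k)) /\
     (frobenius_norm (E k) @[k --> \oo] --> (0 : R))).
Proof.
move=> b EZ E rho0.
have b0 : 0 <= b by exact: spectral_norm_ge0.
have EZ0 : 0 <= frobenius_norm EZ by exact: frobenius_norm_ge0.
have E0 k : 0 <= frobenius_norm (E k) by exact: frobenius_norm_ge0.
have quad k : frobenius_norm (E k.+1) <=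
    2 * b * frobenius_norm EZ * frobenius_norm (E k)
    + b * frobenius_norm (E k) ^+ 2.
  apply: frobenius_norm_sylvester_error => //.
  by rewrite (complex_mx_principal_sqrt_mul _ _ hX).
split=> // rho1.
have rate := linear_rate_of_quadratic_bound _ _
  (fun k => frobenius_norm (E k)) b0 EZ0 E0 quad rho1.
split=> //; apply: (cvg_to_0_linear_rate rho0) => //.
by rewrite mulr_ge0// addr_ge0// mulr_ge0.
Qed.
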